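(* Let $\xi=(G,\mathcal{L},\mathcal{A})$ be an irreducible triplet all of whose spaces $L_1,\dots,L_n$ are nontrivial ($\dim L_i\ge 1$). Then $\xi$ is non-defective: for a multinorm fixed on $\xi$, there is a constant $C$ such that $\|\Pi_\alpha\|\le C\,\rho(\xi)^{|\alpha|}$ for all paths $\alpha$ along $G$.
   Context: A triplet (system) $\xi=(G,\mathcal{L},\mathcal{A})$ consists of: a finite directed multigraph $G$ with vertices $1,\dots,n$ (loops and multiple edges allowed, finitely many edges); finite-dimensional real linear spaces $\mathcal{L}=(L_1,\dots,L_n)$, $L_i$ attached to vertex $i$; and, for every edge from $i$ to $j$, a linear operator $A_{ji}:L_i\to L_j$. $\mathcal{A}_{ji}$ is the finite (possibly empty) family of operators of edges from $i$ to $j$, and $\mathcal{A}=\bigcup_{i,j}\mathcal{A}_{ji}$. A path $\alpha$ is a sequence of consecutive edges; $|\alpha|$ is its number of edges. For a path $i_1\to i_2\to\dots\to i_{k+1}$ with operators $A_{i_{s+1}i_s}$, $\Pi_\alpha=A_{i_{k+1}i_k}\cdots A_{i_2i_1}:L_{i_1}\to L_{i_{k+1}}$. The empty path at a vertex has length $0$ and corresponds to the identity; $0^0=1$. A multinorm is a collection of norms $\|\cdot\|_i$ on $L_i$, $i=1,\dots,n$; for an operator $A:L_i\to L_j$, $\|A\|=\sup_{\|x\|_i=1}\|Ax\|_j$. The joint spectral radius is $\rho(\xi)=\lim_{k\to\infty}\max_{|\alpha|=k}\|\Pi_\alpha\|^{1/k}$ (the limit exists and does not depend on the multinorm; a maximum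 over an empty set is $0$). A triplet $\xi'=(G,\mathcal{L}',\mathcal{A}')$ (same multigraph, spaces not all zero) is embedded in $\xi$ if $L_i'\subset L_i$ is a subspace for each $i$ and for every edge from $i$ to $j$ its operator in $\xi'$ is the restriction $A_{ji}|_{L_i'}$, which maps $L_i'$ into $L_j'$. Some, but not all, of the spaces $L'_i$ may be $\{0\}$. The embedding is strict if $L_i'\ne L_i$ for at least one $i$. $\xi$ is reducible if it has a strictly embedded triplet, and irreducible otherwise. *)

(* Defs.v *)
From HB Require Import structures.
From mathcomp Require Import all_boot all_order all_algebra.
From mathcomp Require Import all_classical all_reals all_analysis.
Set Implicit Arguments.
Unset Strict Implicit.
Unset Printing Implicit Defensive.
Import Order.TTheory GRing.Theory Num.Theory.
Import numFieldNormedType.Exports.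
Local Open Scope classical_set_scope.
Local Open Scope ring_scope.

(* [edge i j] is the finite, possibly empty, type of edges from [i] to [j]:
   loops (i = j) and parallel edges are allowed. *)
Record multigraph := Multigraph {
  nvertex : nat;
  edge : 'I_nvertex -> 'I_nvertex -> finType
}.

Definition vertex (G : multigraph) : Type := 'I_(nvertex G).

(* [edge_operator xi e] is the operator A_ji : L_i -> L_j of the edge [e] from
   [i] to [j]. *)
Record triplet (R : realType) (G : multigraph) := Triplet {
  vertex_space : vertex G -> vectType R;
  edge_operator : forall i j : vertex G,
    edge i j -> 'Hom(vertex_space i, vertex_space j)
}.

Inductive gpath (G : multigraph) (i : vertex G) : vertex G -> Type :=
| gpath_nil : gpath i i
| gpath_rcons (j k : vertex G) (p : gpath i j) (e : edge j k) : gpath i k.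

Fixpoint gpath_size (G : multigraph) (i j : vertex G) (p : gpath i j) : nat :=
  match p with
  | gpath_nil => 0
  | gpath_rcons _ _ q _ => (gpath_size q).+1
  end.

Fixpoint path_operator (R : realType) (G : multigraph) (xi : triplet R G)
    (i j : vertex G) (p : gpath i j)
    : 'Hom(vertex_space xi i, vertex_space xi j) :=
  match p in gpath _ j' return 'Hom(vertex_space xi i, vertex_space xi j') with
  | gpath_nil => \1%VF
  | gpath_rcons _ _ q e => (edge_operator xi e \o path_operator xi q)%VF
  end.

(* A bare norm on a vector space. The normed-module structures attach a single
   canonical norm, with its topology, to a type, whereas the norms here vary
   over a fixed space; the axioms are those of [Lmodule_isNormed]. *)
Record norm_on (R : realType) (V : lmodType R) := NormOn {
  norm_fun :> V -> R;
  norm_onD : forall x y, norm_fun (x + y) <= norm_fun x + norm_fun y;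
  norm_onZ : forall (a : R) x, norm_fun (a *: x) = `|a| * norm_fun x;
  norm_on0_eq0 : forall x, norm_fun x = 0 -> x = 0
}.

Definition multinorm (R : realType) (G : multigraph) (xi : triplet R G) : Type :=
  forall i : vertex G, norm_on (vertex_space xi i).

(* On the zero space the supremum is over the empty set, hence 0. *)
Definition operator_norm (R : realType) (U V : vectType R)
    (NU : norm_on U) (NV : norm_on V) (f : 'Hom(U, V)) : R :=
  sup [set NV (f x) | x in [set x | NU x = 1]].

Definition path_norm (R : realType) (G : multigraph) (xi : triplet R G)
    (N : multinorm xi) (i j : vertex G) (p : gpath i j) : R :=
  operator_norm (N i) (N j) (path_operator xi p).

(* max over |p| = k of ||Pi_p||^(1/k). There are finitely many paths of length
   k, so this supremum is a maximum, and it is 0 if there is none. *)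
Definition max_path_norm_root (R : realType) (G : multigraph) (xi : triplet R G)
    (N : multinorm xi) (k : nat) : R :=
  sup [set r | exists (i j : vertex G) (p : gpath i j),
         gpath_size p = k /\ r = path_norm N p `^ (k%:R^-1)].

(* The value does not depend on the multinorm [N] used to compute it. *)
Definition joint_spectral_radius (R : realType) (G : multigraph)
    (xi : triplet R G) (N : multinorm xi) : R :=
  lim (max_path_norm_root N k @[k --> \oo]).

(* A triplet over the same multigraph, not all of whose spaces are zero, whose
   spaces are subspaces of those of [xi] and whose operators are restrictions;
   the existence of [sub_operator] with [sub_operatorE] includes that each
   operator of [xi] maps the source subspace into the target one. *)
Record embedded_triplet (R : realType) (G : multigraph) (xi : triplet R G) :=
  EmbeddedTriplet {
    sub_space : forall i : vertex G, {vspace vertex_space xi i};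
    sub_operator : forall i j : vertex G, edge i j ->
      'Hom(subvs_of (sub_space i), subvs_of (sub_space j));
    sub_operatorE : forall (i j : vertex G) (e : edge i j)
      (x : subvs_of (sub_space i)),
      vsval (sub_operator e x) = edge_operator xi e (vsval x);
    sub_space_neq0 : exists i : vertex G, sub_space i != 0%VS
  }.

Definition triplet_of_embedded (R : realType) (G : multigraph)
    (xi : triplet R G) (eta : embedded_triplet xi) : triplet R G :=
  @Triplet R G (fun i => subvs_of (sub_space eta i)) (@sub_operator R G xi eta).

Definition strict_embedding (R : realType) (G : multigraph) (xi : triplet R G)
    (eta : embedded_triplet xi) : Prop :=
  exists i : vertex G, sub_space eta i <> fullv.

Definition reducible_triplet (R : realType) (G : multigraph) (xi : triplet R G)
    : Prop :=
  exists eta : embedded_triplet xi, strict_embedding eta.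

Definition irreducible_triplet (R : realType) (G : multigraph) (xi : triplet R G)
    : Prop :=
  ~ reducible_triplet xi.

Definition nondefective (R : realType) (G : multigraph) (xi : triplet R G)
    (N : multinorm xi) : Prop :=
  exists C : R, forall (i j : vertex G) (p : gpath i j),
    path_norm N p <= C * joint_spectral_radius N ^+ gpath_size p.

(* Main.v *)
Require Import Defs.
From mathcomp Require Import all_boot all_order all_algebra.
From mathcomp Require Import all_classical all_reals all_analysis.
Set Implicit Arguments.
Unset Strict Implicit.
Unset Printing Implicit Defensive.
Import Order.TTheory GRing.Theory Num.Theory.
Import numFieldNormedType.Exports.
Import VectorInternalTheory.
Local Open Scope classical_set_scope.
Local Open Scope ring_scope.

(** Write [rho] for the joint spectral radius and call a vector [x] at a vertex
    [i] slow if [N (Pi_p x) <= C * rho ^ |p|] for some [C] and all paths [p]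
    from [i].  Slow vectors form subspaces that every edge operator respects,
    since prefixing a path with an edge only multiplies the constant by [rho]
    (also when [rho = 0]).  Irreducibility therefore leaves two cases
    ([irreducible_invariant]): all vectors are slow, or only the zero vectors.

    If all vectors are slow, a bound on finitely many basis vectors at each of
    the finitely many vertices is a bound on the operators, which is the claim
    ([nondefective_of_slow]).

    If no nonzero vector is slow, then every [x != 0] has a path [p] with
    [N (Pi_p x) > rho ^ |p| * N x].  By compactness of spheres [rho] can be
    replaced here by one [r > rho] that serves all vectors at all vertices
    ([expansion_of_no_slow]).  Such a path has length at least 1, and the
    argument applies again to [Pi_p x]: concatenating, one finds arbitrarily
    long paths with [N (Pi_p x) >= r ^ |p| * N x] ([expanding_paths]).  But for
    every [t > rho] all path norms are at most [D * t ^ |p|]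
    ([joint_spectral_radius_bound]); a [t] strictly between [rho] and [r] gives
    a contradiction.  The case [rho = 0] needs no separate treatment: that is
    why the expansion is stated with a rate [r > rho] and not with a constant
    factor in front of [rho ^ |p|].

    That last bound is Fekete's argument: the largest path norm of length [k]
    is submultiplicative in [k], so its [k]-th root converges to its infimum
    over [k >= 1]. *)

(** * Seminorms on finite-dimensional spaces *)

(** Seminorms rather than norms: the functions [x |-> N (Pi_p x)] vanish on the
    kernel of [Pi_p]. *)
Definition seminorm (R : realType) (V : lmodType R) (q : V -> R) : Prop :=
  (forall x y, q (x + y) <= q x + q y) /\
  (forall (a : R) x, q (a *: x) = `|a| * q x).

Section Seminorms.
Variables (R : realType) (V : vectType R).
Implicit Types (q : V -> R) (x y : V).

Lemma seminorm_norm (N : norm_on V) : seminorm N.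
Proof. by split; [exact: norm_onD | exact: norm_onZ]. Qed.

Lemma seminorm_comp (W : vectType R) (N : norm_on W) (f : 'Hom(V, W)) :
  seminorm (N \o f).
Proof.
by split=> [x y|a x] /=; rewrite ?linearD ?linearZ ?norm_onZ ?norm_onD.
Qed.

Lemma seminorm_v2r : seminorm (fun x => `|v2r x|).
Proof.
by split=> [x y|a x] /=; rewrite ?linearD ?linearZ ?normrZ // ler_normD.
Qed.

Lemma seminorm0 q : seminorm q -> q 0 = 0.
Proof. by case=> _ qZ; rewrite -(scale0r 0) qZ normr0 mul0r. Qed.

Lemma seminormN q x : seminorm q -> q (- x) = q x.
Proof. by case=> _ qZ; rewrite -scaleN1r qZ normrN1 mul1r. Qed.

Lemma seminorm_ge0 q x : seminorm q -> 0 <= q x.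
Proof.
move=> qs; have := qs.1 x (- x); rewrite subrr seminorm0// seminormN//.
by rewrite -mulr2n pmulrn_lge0.
Qed.

Lemma norm_on_gt0 (N : norm_on V) x : x != 0 -> 0 < N x.
Proof.
move=> x0; rewrite lt_def (seminorm_ge0 _ (seminorm_norm N)) andbT.
by apply: contra x0 => /eqP/norm_on0_eq0 ->.
Qed.

Lemma seminorm_dist q x y : seminorm q -> `|q x - q y| <= q (x - y).
Proof.
move=> qs; rewrite ler_norml; apply/andP; split.
  rewrite lerNl opprB lerBlDr -[q (x - y)]seminormN// opprB.
  by have := qs.1 (y - x) x; rewrite subrK.
by rewrite lerBlDr; have := qs.1 (x - y) y; rewrite subrK.
Qed.

(** Coordinates [v2r] give an abstract finite-dimensional space the topology of
    row vectors; expanding [x] in the basis [r2v (delta_mx 0 i)] bounds any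
    seminorm by the sup norm of the coordinates, hence makes it continuous. *)
Lemma seminorm_le_coord q : seminorm q -> forall x,
  q x <= (\sum_i q (r2v (delta_mx 0 i))) * `|v2r x|.
Proof.
move=> qs x; rewrite -{1}[x]v2rK {1}[v2r x]row_sum_delta linear_sum.
apply: (@le_trans _ _
  (\sum_i q (r2v (v2r x 0 i *: delta_mx 0 i : 'rV_(dim V))))).
  apply: (big_ind2 (fun a b => q a <= b)).
  - by rewrite seminorm0.
  - by move=> a b c d ab cd; apply: (le_trans (qs.1 _ _)); rewrite lerD.
  - by [].
rewrite mulr_suml; apply: ler_sum => i _.
rewrite linearZ qs.2 mulrC ler_wpM2l ?seminorm_ge0//.
rewrite [leRHS]/Num.Def.normr /= mx_normrE; apply/bigmax_geP; right.
by exists (0, i).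
Qed.

Lemma seminorm_continuous q : seminorm q ->
  continuous (q \o r2v : 'rV[R]_(dim V) -> R).
Proof.
move=> qs v; apply/(@cvgrPdist_lt _ _ _ (nbhs v) (nbhs_filter v)) => e e0.
set S := \sum_i q (r2v (delta_mx 0 i)).
have S0 : 0 <= S by apply: sumr_ge0 => i _; exact: seminorm_ge0.
have S1 : 0 < S + 1 by rewrite ltr_pwDr.
near=> w => /=; apply: (le_lt_trans (seminorm_dist _ _ qs)).
apply: (le_lt_trans (seminorm_le_coord qs _)).
rewrite linearB /= !r2vK -/S.
apply: (@le_lt_trans _ _ ((S + 1) * `|v - w|)).
  by rewrite ler_wpM2r// lerDl.
rewrite mulrC -ltr_pdivlMr//; near: w.
by apply: (@cvgr_dist_lt _ _ _ (nbhs v)) => //; rewrite divr_gt0.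
Unshelve. all: by end_near. Qed.

Lemma sphere_compact : compact [set v : 'rV[R]_(dim V) | `|v| = 1].
Proof.
apply: bounded_closed_compact.
  by exists 1; split; [exact: num_real|] => M M1 v /= ->; exact: ltW.
have -> : [set v : 'rV[R]_(dim V) | `|v| = 1] =
    (fun v : 'rV[R]_(dim V) => `|v|) @^-1` [set 1] by [].
apply: closed_comp; first by move=> v _; exact: norm_continuous.
exact: (@closed_eq R 1).
Qed.

(** Both sides of [q a x <= u a n * p x] are homogeneous, so approximate
    solutions can be taken on the coordinate sphere, where they accumulate at an
    exact solution.  This is the only use of compactness: it gives the
    equivalence of norms, with [p] the coordinate norm, and the uniform expansion
    rate, with one [q a] for each path. *)
Lemma seminorm_limit (I : Type) (q : I -> V -> R) (p : V -> R)
    (u : I -> nat -> R) (l : I -> R) :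
  (forall a, seminorm (q a)) -> seminorm p ->
  (forall a, u a n @[n --> \oo] --> l a) ->
  (forall n, exists2 x, x != 0 & forall a, q a x <= u a n * p x) ->
  exists2 x, x != 0 & forall a, q a x <= l a * p x.
Proof.
move=> qs ps ul Hx.
have {Hx} Hy n : exists v : 'rV[R]_(dim V), `|v| = 1 /\
    forall a, q a (r2v v) <= u a n * p (r2v v).
  have [x x0 xn] := Hx n; have vx0 : 0 < `|v2r x|.
    rewrite normr_gt0; apply: contraNneq x0 => vx0.
    by rewrite -[x]v2rK vx0 linear0.
  exists (`|v2r x|^-1 *: v2r x); split=> [|a].
    by rewrite normrZ normfV normr_id mulVf ?gt_eqF.
  rewrite linearZ /= v2rK (qs a).2 ps.2 mulrCA ler_wpM2l//.
have [y {}Hy] := choice Hy.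
have yP : ProperFilter (y @ \oo) by exact: fmap_proper_filter.
have yS : (y @ \oo) [set v | `|v| = 1].
  by exists 0%N => // n _; exact: (Hy n).1.
(* [v] is a cluster point of the sequence [y]; [r2v v] is the solution. *)
have [v [v1 vcl]] := sphere_compact yP yS.
exists (r2v v) => [|a].
  apply/negP => /eqP v0; move: v1 => /=.
  rewrite -[v]r2vK v0 linear0 normr0 => /esym/eqP.
  by rewrite oner_eq0.
(* Otherwise [h v > 0], and [h > h v / 2] near [v]; but [h (y n) <= h v / 2]
   eventually, as [p] is bounded by [M] near [v] and [u a n] tends to [l a]. *)
rewrite leNgt; apply/negP => hv.
pose h (w : 'rV[R]_(dim V)) := q a (r2v w) - l a * p (r2v w).
pose M := p (r2v v) + 1.
have M0 : 0 < M by rewrite ltr_pwDr// seminorm_ge0.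
have d0 : 0 < h v by rewrite subr_gt0.
have qc : q a (r2v w) @[w --> v] --> q a (r2v v).
  exact: (seminorm_continuous (qs a) (x := v)).
have pc : p (r2v w) @[w --> v] --> p (r2v v).
  exact: (seminorm_continuous ps (x := v)).
have hc : h w @[w --> v] --> h v.
  exact: (cvgB qc (cvgM (cvg_cst _) pc)).
have B : nbhs v [set w | h v / 2 < h w /\ p (r2v w) < M].
  near=> w; split; near: w.
    by apply: (cvgr_gt _ hc); rewrite ltr_pdivrMr// ltr_pMr// ltr1n.
  by apply: (cvgr_lt _ pc); rewrite ltrDl.
have A : (y @ \oo) [set w | h w <= h v / 2 \/ M <= p (r2v w)].
  have e0 : 0 < h v / 2 / M by rewrite !divr_gt0.
  have : \forall n \near \oo, `|l a - u a n| < h v / 2 / M.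
    by have /cvgrPdist_lt := ul a; apply.
  apply: filterS => n /= un.
  have [|pM] := leP M (p (r2v (y n))); [by right | left].
  rewrite /h; apply: (@le_trans _ _ ((u a n - l a) * p (r2v (y n)))).
    by rewrite mulrBl lerD2r (Hy n).2.
  apply: (@le_trans _ _ (h v / 2 / M * M)); last by rewrite divfK ?gt_eqF.
  apply: (@le_trans _ _ (`|l a - u a n| * p (r2v (y n)))).
    by rewrite ler_wpM2r ?seminorm_ge0// distrC ler_norm.
  by rewrite ler_pM ?seminorm_ge0// ltW.
have [w [[]]] := vcl _ _ A B.
  by move=> hw [/lt_le_trans/(_ hw)]; rewrite ltxx.
by move=> hw [_ /lt_le_trans/(_ hw)]; rewrite ltxx.
Unshelve. all: by end_near. Qed.

End Seminorms.

Lemma sup_nonneg (R : realType) (E : set R) :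
  (forall x, E x -> 0 <= x) -> 0 <= sup E.
Proof.
move=> E0; have [supE|/sup_out -> //] := pselect (has_sup E).
have [x Ex] := supE.1; exact: le_trans (E0 x Ex) (ub_le_sup supE.2 Ex).
Qed.

(** * Operator norms *)

Section OperatorNorms.
Variable R : realType.
Implicit Types U V W : vectType R.

(** If no constant works, then [N x <= harmonic n * `|v2r x|] has a nonzero
    solution for each [n], and in the limit some nonzero [x] has [N x = 0]. *)
Lemma norm_dominates_coord V (N : norm_on V) :
  exists2 c, 0 < c & forall x, `|v2r x| <= c * N x.
Proof.
apply: contrapT => H.
have [x x0] : exists2 x : V, x != 0 & forall a : unit, N x <= 0 * `|v2r x|.
  apply: (@seminorm_limit _ _ _ (fun=> N) _ (fun=> @harmonic R)).
  - by move=> _; exact: seminorm_norm.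
  - exact: seminorm_v2r.
  - by move=> _; exact: cvg_harmonic.
  - move=> n; apply: contrapT => Hn; apply: H; exists n.+1%:R => // x.
    rewrite leNgt; apply/negP => xn; apply: Hn; exists x => [|_].
      apply: contraTneq xn => ->.
      by rewrite linear0 normr0 (seminorm0 (seminorm_norm N)) mulr0 ltxx.
    by rewrite /harmonic /= mulrC ler_pdivlMr// mulrC ltW.
rewrite mul0r => /(_ tt) Nx; case/eqP: x0; apply: (norm_on0_eq0 (n := N)).
by apply/eqP; rewrite eq_le Nx (seminorm_ge0 _ (seminorm_norm N)).
Qed.

(** The constant [c] does not depend on [q]: this uniformity turns bounds on a
    basis into bounds for infinitely many seminorms at once. *)
Lemma norm_dominates_seminorm V (N : norm_on V) :
  exists2 c, 0 < c & forall q, seminorm q ->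
    forall x, q x <= c * (\sum_i q (r2v (delta_mx 0 i))) * N x.
Proof.
have [c c0 cN] := norm_dominates_coord N; exists c => // q qs x.
apply: (le_trans (seminorm_le_coord qs x)).
rewrite [c * _]mulrC -mulrA ler_wpM2l//.
by apply: sumr_ge0 => i _; exact: seminorm_ge0.
Qed.

Lemma operator_norm_ge0 U V (NU : norm_on U) (NV : norm_on V) (f : 'Hom(U, V)) :
  0 <= operator_norm NU NV f.
Proof.
apply: sup_nonneg => _ [x _ <-].
exact: (seminorm_ge0 (V := V) _ (seminorm_norm NV)).
Qed.

(** The content is that the supremum is over a bounded set; the supremum of an
    unbounded set is 0 by convention. *)
Lemma operator_normP U V (NU : norm_on U) (NV : norm_on V) (f : 'Hom(U, V)) x :
  NV (f x) <= operator_norm NU NV f * NU x.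
Proof.
have [->|x0] := eqVneq x 0.
  rewrite linear0 (seminorm0 (seminorm_norm NV)).
  by rewrite (seminorm0 (seminorm_norm NU)) mulr0.
have Nx := norm_on_gt0 NU x0.
rewrite -ler_pdivrMr// mulrC -[X in X * _](ger0_norm (x := (NU x)^-1));
  last by rewrite invr_ge0 ltW.
rewrite -norm_onZ -linearZ /operator_norm; apply: ub_le_sup; last first.
  exists ((NU x)^-1 *: x) => //=.
  by rewrite norm_onZ ger0_norm ?invr_ge0 ?(ltW Nx)// mulVf// gt_eqF.
have [c c0 cN] := norm_dominates_seminorm NU.
exists (c * \sum_i (NV \o f) (r2v (delta_mx 0 i))) => _ [y /= y1 <-].
by have := cN _ (seminorm_comp NV f) y; rewrite y1 mulr1.
Qed.

Lemma operator_norm_le U V (NU : norm_on U) (NV : norm_on V)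
    (f : 'Hom(U, V)) c :
  0 <= c -> (forall x, NV (f x) <= c * NU x) -> operator_norm NU NV f <= c.
Proof.
move=> c0 fc; rewrite /operator_norm; set S := [set _ | _ in _].
have [->|/set0P S0] := eqVneq S set0; first by rewrite sup0.
by apply: ge_sup => // _ [x /= x1 <-]; have := fc x; rewrite x1 mulr1.
Qed.

Lemma operator_norm_comp U V W (NU : norm_on U) (NV : norm_on V)
    (NW : norm_on W) (f : 'Hom(U, V)) (g : 'Hom(V, W)) :
  operator_norm NU NW (g \o f)%VF <=
    operator_norm NV NW g * operator_norm NU NV f.
Proof.
apply: operator_norm_le => [|x].
  by rewrite mulr_ge0 ?operator_norm_ge0.
rewrite comp_lfunE -mulrA; apply: (le_trans (operator_normP NV NW g _)).
by rewrite ler_wpM2l ?operator_norm_ge0// operator_normP.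
Qed.

End OperatorNorms.

(** Pointwise bounds suffice, as [norm_dominates_seminorm] reduces to the
    finitely many basis vectors. *)
Lemma seminorm_uniform_bound (R : realType) (V : vectType R) (N : norm_on V)
    (I : Type) (q : I -> V -> R) (s : I -> R) :
  (forall a, seminorm (q a)) -> (forall a, 0 <= s a) ->
  (forall x, exists C, forall a, q a x <= C * s a) ->
  exists2 C, 0 <= C & forall a x, q a x <= C * s a * N x.
Proof.
move=> qs s0 /choice[C HC]; have [c c0 Hc] := norm_dominates_seminorm N.
pose D := \sum_i `|C (r2v (delta_mx 0 i))|.
exists (c * D); first by rewrite mulr_ge0 ?sumr_ge0// ltW.
move=> a x; apply: (le_trans (Hc _ (qs a) x)).
rewrite ler_wpM2r ?(seminorm_ge0 _ (seminorm_norm N))//.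
rewrite -mulrA ler_wpM2l ?(ltW c0)//.
rewrite mulr_suml; apply: ler_sum => i _; apply: (le_trans (HC _ _)).
by rewrite ler_wpM2r// ler_norm.
Qed.

(** * Invariant families of subspaces *)

(** A subspace of maximal dimension among those contained in [P] is all of [P]:
    otherwise add a line to it. *)
Lemma vspace_of_closed (R : realType) (V : vectType R) (P : V -> Prop) :
  P 0 -> (forall (a : R) x y, P x -> P y -> P (a *: x + y)) ->
  exists W : {vspace V}, forall x, x \in W <-> P x.
Proof.
move=> P0 PD.
pose dimP n :=
  `[< exists W : {vspace V}, (forall x, x \in W -> P x) /\ \dim W = n >].
have ex0 : exists n, dimP n.
  exists 0%N; apply/asboolP; exists 0%VS; split; last exact: dimv0.
  by move=> x; rewrite memv0 => /eqP ->.
have ub n : dimP n -> (n <= \dim {:V})%N.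
  by move=> /asboolP[W [_ <-]]; rewrite dimvS// subvf.
have [n /asboolP[W [WP Wn]] nmax] := ex_maxnP ex0 ub.
exists W => x; split=> [|Px]; first exact: WP.
have : dimP (\dim (<[x]> + W)%VS).
  apply/asboolP; exists (<[x]> + W)%VS; split=> // y.
  by move=> /memv_addP[_ /vlineP[a ->] [w Ww ->]]; apply: PD => //; exact: WP.
move=> /nmax; rewrite -Wn => dimW.
have /eqP -> : W == (<[x]> + W)%VS by rewrite eqEdim addvSr.
exact: (subvP (addvSl _ _)) (memv_line x).
Qed.

Section Irreducible.
Variables (R : realType) (G : multigraph) (xi : triplet R G).

(** If the family is neither zero nor full, its restricted edge operators form a
    strictly embedded triplet. *)
Lemma irreducible_invariant
    (W : forall i : vertex G, {vspace vertex_space xi i}) :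
  irreducible_triplet xi ->
  (forall (i j : vertex G) (e : edge i j) x,
     x \in W i -> edge_operator xi e x \in W j) ->
  (forall i, W i = 0%VS) \/ (forall i, W i = fullv).
Proof.
move=> irr inv.
have [|/existsNP[i Wi]] := pselect (forall i, W i = 0%VS); first by left.
right=> j; apply: contrapT => Wj; apply: irr.
pose f i j (e : edge i j) : 'Hom(subvs_of (W i), subvs_of (W j)) :=
  linfun (vsproj (W j) \o edge_operator xi e \o vsval).
have fE i' j' (e : edge i' j') (x : subvs_of (W i')) :
    vsval (f i' j' e x) = edge_operator xi e (vsval x).
  by rewrite lfunE /= vsprojK// inv// subvsP.
by unshelve eexists (EmbeddedTriplet fE _); [exists i; apply/eqP | exists j].
Qed.

End Irreducible.

(** * Concatenation of paths *)

Section Paths.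
Variable G : multigraph.
Implicit Types i j k : vertex G.

Fixpoint gpath_cat i j k (p : gpath i j) (q : gpath j k) : gpath i k :=
  match q in gpath _ k' return gpath i k' with
  | gpath_nil => p
  | gpath_rcons _ _ q' e => gpath_rcons (gpath_cat p q') e
  end.

Lemma gpath_size_cat i j k (p : gpath i j) (q : gpath j k) :
  gpath_size (gpath_cat p q) = (gpath_size p + gpath_size q)%N.
Proof. by elim: q => [|l m q IH e] /=; rewrite ?addn0 ?addnS ?IH. Qed.

Lemma gpath_take i k (p : gpath i k) m : (m <= gpath_size p)%N ->
  exists j (q : gpath i j) (r : gpath j k),
    gpath_size q = m /\ p = gpath_cat q r.
Proof.
elim: p => [|j l p IH e] /=.
  by rewrite leqn0 => /eqP ->; exists i, (gpath_nil i), (gpath_nil i).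
rewrite leq_eqVlt => /predU1P[->|]; last first.
  rewrite ltnS => /IH[h [q [r [qm ->]]]].
  by exists h, q, (gpath_rcons r e).
by exists l, (gpath_rcons p e), (gpath_nil l).
Qed.

End Paths.

(** * The joint spectral radius *)

Section PathNorms.
Variables (R : realType) (G : multigraph) (xi : triplet R G) (N : multinorm xi).
Implicit Types i j k : vertex G.

Lemma path_operator_cat i j k (p : gpath i j) (q : gpath j k) :
  path_operator xi (gpath_cat p q) =
  (path_operator xi q \o path_operator xi p)%VF.
Proof.
by elim: q => [|l m q IH e] /=; rewrite ?comp_lfun1l// IH comp_lfunA.
Qed.

Lemma path_norm_ge0 i j (p : gpath i j) : 0 <= path_norm N p.
Proof. exact: operator_norm_ge0. Qed.

Lemma path_norm_cat i j k (p : gpath i j) (q : gpath j k) :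
  path_norm N (gpath_cat p q) <= path_norm N q * path_norm N p.
Proof. by rewrite /path_norm path_operator_cat operator_norm_comp. Qed.

(** The sum of the norms of all edge operators serves as [M].  The
    bound keeps the set of [k]-th roots in [max_path_norm_root] bounded. *)
Lemma path_norm_geometric :
  exists2 M, 0 <= M &
    forall i j (p : gpath i j), path_norm N p <= M ^+ gpath_size p.
Proof.
pose opn i j (e : edge i j) := operator_norm (N i) (N j) (edge_operator xi e).
pose S :=
  \sum_(i < nvertex G) \sum_(j < nvertex G) \sum_(e : edge i j) opn i j e.
have opn_le i j (e : edge i j) : opn i j e <= S.
  have opn0 i' j' e' : 0 <= opn i' j' e' by exact: operator_norm_ge0.
  rewrite /S (bigD1 i)//= (bigD1 j)//= (bigD1 e)//=.
  rewrite -!addrA lerDl !addr_ge0 ?sumr_ge0// => *; rewrite ?sumr_ge0// => *.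
  by rewrite sumr_ge0.
exists S; first by do 3!apply: sumr_ge0 => ? _; exact: operator_norm_ge0.
move=> i j; elim=> [|k l p IH e] /=.
  apply: operator_norm_le => // x.
  by rewrite /= lfunE /= expr0 mul1r.
rewrite /path_norm /=; apply: (le_trans (operator_norm_comp _ (N k) _ _ _)).
by rewrite exprS ler_pM ?operator_norm_ge0// opn_le.
Qed.

Lemma path_norm_le_root (k : nat) (k0 : (0 < k)%N) i j (p : gpath i j) :
  gpath_size p = k -> path_norm N p <= max_path_norm_root N k ^+ k.
Proof.
move=> pk; have [M M0 HM] := path_norm_geometric.
have k0R : k%:R != 0 :> R by rewrite pnatr_eq0 -lt0n.
have -> : path_norm N p = (path_norm N p `^ k%:R^-1) ^+ k.
  by rewrite -powR_mulrn ?powR_ge0// -powRrM mulVf// powRr1// path_norm_ge0.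
rewrite lerXn2r ?nnegrE ?powR_ge0//.
  by apply: sup_nonneg => _ [? [? [? [_ ->]]]]; exact: powR_ge0.
rewrite /max_path_norm_root; apply: ub_le_sup; last by exists i, j, p.
exists M => _ [i' [j' [q [qk ->]]]].
have -> : M = (M ^+ k) `^ k%:R^-1.
  by rewrite -powR_mulrn// -powRrM mulfV// powRr1.
by rewrite ge0_ler_powR ?nnegrE ?invr_ge0 ?path_norm_ge0 ?exprn_ge0// -qk.
Qed.

Lemma max_path_norm_root_ge0 (k : nat) : 0 <= max_path_norm_root N k.
Proof. by apply: sup_nonneg => _ [? [? [? [_ ->]]]]; exact: powR_ge0. Qed.

Lemma max_path_norm_root_le (k : nat) (k0 : (0 < k)%N) (t : R) : 0 <= t ->
  (forall i j (p : gpath i j), gpath_size p = k -> path_norm N p <= t ^+ k) ->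
  max_path_norm_root N k <= t.
Proof.
move=> t0 Ht; rewrite /max_path_norm_root; set S := [set _ | _].
have [->|/set0P S0] := eqVneq S set0; first by rewrite sup0.
apply: ge_sup => // _ [i [j [p [pk ->]]]].
have k0R : k%:R != 0 :> R by rewrite pnatr_eq0 -lt0n.
have -> : t = (t ^+ k) `^ k%:R^-1.
  by rewrite -powR_mulrn// -powRrM mulfV// powRr1.
by rewrite ge0_ler_powR ?nnegrE ?invr_ge0 ?path_norm_ge0 ?exprn_ge0// Ht.
Qed.

(** Cut a path into pieces of length [m], each of norm at most [t ^+ m], and a
    last piece shorter than [m], of norm at most [(M / t) ^+ s * t ^+ s] where
    [s] is its length; the first factor goes into the constant. *)
Lemma path_norm_bound_of_root m (t : R) : (0 < m)%N -> 0 < t ->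
  max_path_norm_root N m <= t ->
  exists2 D, 0 < D &
    forall i j (p : gpath i j), path_norm N p <= D * t ^+ gpath_size p.
Proof.
move=> m0 t0 bt; have [M M0 HM] := path_norm_geometric.
have Q1 : 1 <= 1 + M / t by rewrite lerDl divr_ge0// ltW.
exists ((1 + M / t) ^+ m); first by rewrite exprn_gt0// (lt_le_trans _ Q1).
move=> i j p; have [n] := ubnP (gpath_size p).
elim: n i p => // n IH i p; rewrite ltnS => pn.
have [pm|mp] := ltnP (gpath_size p) m.
  apply: (le_trans (HM _ _ _)).
  rewrite -{1}[M](divfK (lt0r_neq0 t0)) exprMn ler_wpM2r ?exprn_ge0 ?(ltW t0)//.
  apply: (@le_trans _ _ ((1 + M / t) ^+ gpath_size p)).
    have Mt0 : 0 <= M / t by rewrite divr_ge0// ltW.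
    by apply: lerXn2r; rewrite ?nnegrE ?lerDr// (le_trans ler01).
  by rewrite ler_weXn2l// ltnW.
have [h [q [r [qm pE]]]] := gpath_take mp.
have sE : gpath_size p = (gpath_size r + m)%N.
  by rewrite pE gpath_size_cat qm addnC.
rewrite {1}pE; apply: (le_trans (path_norm_cat _ _)).
rewrite sE exprD mulrA ler_pM ?path_norm_ge0//.
  apply: IH; rewrite -(ltn_add2r m) -sE; apply: (leq_ltn_trans pn).
  by rewrite -[X in (X < _)%N]addn0 ltn_add2l.
apply: (le_trans (path_norm_le_root m0 qm)).
by rewrite lerXn2r ?nnegrE ?max_path_norm_root_ge0 ?(ltW t0).
Qed.

(** Passing from [t] to the larger [s] absorbs the constant, as
    [D * (t / s) ^+ k <= 1] for large [k]. *)
Lemma max_path_norm_root_near (D t s : R) : 0 < D -> 0 < t -> t < s ->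
  (forall i j (p : gpath i j), path_norm N p <= D * t ^+ gpath_size p) ->
  \forall k \near \oo, max_path_norm_root N k <= s.
Proof.
move=> D0 t0 ts HD; have s0 : 0 < s by exact: lt_trans ts.
have z1 : `|t / s| < 1.
  by rewrite ger0_norm ?divr_ge0 ?(ltW t0) ?(ltW s0)// ltr_pdivrMr// mul1r.
have Dz : \forall k \near \oo, `|0 - (t / s) ^+ k| < D^-1.
  by have /cvgrPdist_lt := cvg_expr z1; apply; rewrite invr_gt0.
near=> k; apply: max_path_norm_root_le; [|exact: ltW|].
  by near: k; exact: nbhs_infty_gt.
move=> i j p pk; apply: (le_trans (HD _ _ _)); rewrite pk.
have : `|0 - (t / s) ^+ k| < D^-1 by near: k.
rewrite sub0r normrN ger0_norm; last first.
  by rewrite exprn_ge0// divr_ge0 ?(ltW t0) ?(ltW s0).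
rewrite expr_div_n ltr_pdivrMr ?exprn_gt0// => /ltW.
by rewrite -(ler_pM2l D0) mulrA mulfV ?gt_eqF// mul1r.
Unshelve. all: by end_near. Qed.

(** The roots [max_path_norm_root N k] converge to their infimum over [k >= 1]:
    by the two lemmas above, each of them bounds all roots of large index up to
    an arbitrarily small error.  Index 0 is left out because [0^-1 = 0], so the
    root there does not depend on any norm. *)
Lemma joint_spectral_radius_bound :
  0 <= joint_spectral_radius N /\
  forall t : R, joint_spectral_radius N < t -> exists2 D, 0 < D &
    forall i j (p : gpath i j), path_norm N p <= D * t ^+ gpath_size p.
Proof.
pose B := [set max_path_norm_root N k | k in [set k | (0 < k)%N]].
have infB : has_inf B.
  split; first by exists (max_path_norm_root N 1), 1%N.
  by exists 0 => _ [k _ <-]; exact: max_path_norm_root_ge0.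
have r0 : 0 <= inf B.
  apply: lb_le_inf; first by case: infB.
  by move=> _ [k _ <-]; exact: max_path_norm_root_ge0.
have bound (t : R) : inf B < t -> exists2 D, 0 < D &
    forall i j (p : gpath i j), path_norm N p <= D * t ^+ gpath_size p.
  move=> /(inf_lt infB.1)[_ [k /= k0 <-] kt].
  apply: (@path_norm_bound_of_root k) => //; last exact: ltW.
  exact: le_lt_trans (max_path_norm_root_ge0 _) kt.
have bcvg : max_path_norm_root N k @[k --> \oo] --> inf B.
  apply/cvgrPdist_le => e e0.
  have [D D0 HD] : exists2 D, 0 < D & forall i j (p : gpath i j),
      path_norm N p <= D * (inf B + e / 2) ^+ gpath_size p.
    by apply: bound; rewrite ltrDl divr_gt0.
  have near_le : \forall k \near \oo, max_path_norm_root N k <= inf B + e.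
    apply: (max_path_norm_root_near D0 _ _ HD).
      by rewrite ltr_wpDl// divr_gt0.
    by rewrite ltrD2l ltr_pdivrMr// ltr_pMr// ltr1n.
  near=> k; rewrite distrC ger0_norm.
    by rewrite lerBlDl; near: k.
  rewrite subr_ge0; apply: (ge_inf infB.2); exists k => //=.
  by near: k; exact: nbhs_infty_gt.
have -> : joint_spectral_radius N = inf B by exact: cvg_lim bcvg.
by [].
Unshelve. all: by end_near. Qed.

End PathNorms.

(** * Slow vectors *)

Section Growth.
Variables (R : realType) (G : multigraph) (xi : triplet R G) (N : multinorm xi).

Implicit Types i j : vertex G.

Definition expanding (r : R) : Prop :=
  forall i (x : vertex_space xi i), x != 0 ->
  exists j (p : gpath i j),
    r ^+ gpath_size p * N i x < N j (path_operator xi p x).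

(** The inequality in [expanding] is strict, so the empty path never
    satisfies it; repeating the choice of a path therefore gives arbitrarily
    long ones. *)
Lemma expanding_paths (r : R) : 0 < r -> expanding r ->
  forall n i (x : vertex_space xi i), x != 0 ->
    exists j (p : gpath i j), (n <= gpath_size p)%N /\
      r ^+ gpath_size p * N i x <= N j (path_operator xi p x).
Proof.
move=> r0 Hr; elim=> [|n IH] i x x0.
  by exists i, (gpath_nil i); rewrite /= expr0 mul1r id_lfunE.
have [j [p [np px]]] := IH i x x0.
have Nx := norm_on_gt0 (N i) x0.
have y0 : path_operator xi p x != 0.
  apply: contraTneq px => ->; rewrite (seminorm0 (seminorm_norm _)) -ltNge.
  by rewrite mulr_gt0// exprn_gt0.
have [k [q qy]] := Hr j _ y0.
exists k, (gpath_cat p q); rewrite gpath_size_cat path_operator_cat comp_lfunE.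
split.
  rewrite -addn1 leq_add// lt0n; apply: contraTneq qy.
  case: q => [|? ? ? ?] //= _.
  by rewrite expr0 mul1r id_lfunE ltxx.
apply: le_trans (ltW qy).
by rewrite addnC exprD -mulrA ler_wpM2l// exprn_ge0// ltW.
Qed.

Lemma expanding_le_radius (r : R) i (x : vertex_space xi i) :
  x != 0 -> expanding r -> r <= joint_spectral_radius N.
Proof.
move=> x0 Hr; rewrite leNgt; apply/negP => rhor.
have [rho0 Hrho] := joint_spectral_radius_bound N.
set rho := joint_spectral_radius N in rhor rho0 Hrho.
have r0 : 0 < r by exact: le_lt_trans rhor.
have [/Hrho[D D0 HD] tr] := midf_lt rhor.
set t := (rho + r) / 2 in HD tr.
have t0 : 0 <= t by rewrite divr_ge0// addr_ge0// ltW.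
have z1 : `|t / r| < 1.
  have tr0 : 0 <= t / r by rewrite divr_ge0// ltW.
  by rewrite ger0_norm// ltr_pdivrMr// mul1r.
(* Paths of length at least [n] have norm less than [r ^ |p|]. *)
have [n _ nP] : \forall k \near \oo, `|0 - (t / r) ^+ k| < D^-1.
  by have /cvgrPdist_lt := cvg_expr z1; apply; rewrite invr_gt0.
have [j [p [np px]]] := expanding_paths r0 Hr n x0.
have Nx := norm_on_gt0 (N i) x0.
have rD : r ^+ gpath_size p <= D * t ^+ gpath_size p.
  rewrite -(ler_pM2r Nx); apply: (le_trans px).
  apply: (le_trans (operator_normP (N i) (N j) _ _)).
  by rewrite ler_wpM2r ?(ltW Nx)//; exact: HD.
have := nP _ np; rewrite /= sub0r normrN ger0_norm; last first.
  by rewrite exprn_ge0// divr_ge0// ltW.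
rewrite expr_div_n ltr_pdivrMr ?exprn_gt0//.
by rewrite -(ltr_pM2l D0) mulrA mulfV ?gt_eqF// mul1r ltNge rD.
Qed.

Local Notation rho := (joint_spectral_radius N).

Definition slow i (x : vertex_space xi i) : Prop :=
  exists C : R, forall j (p : gpath i j),
    N j (path_operator xi p x) <= C * rho ^+ gpath_size p.

Lemma slow0 i : slow (0 : vertex_space xi i).
Proof.
by exists 0 => j p; rewrite linear0 (seminorm0 (seminorm_norm _)) mul0r.
Qed.

Lemma slow_linear i (a : R) (x y : vertex_space xi i) :
  slow x -> slow y -> slow (a *: x + y).
Proof.
move=> [C HC] [D HD]; exists (`|a| * C + D) => j p.
rewrite linearP /= mulrDl -mulrA; apply: (le_trans (norm_onD _ _ _)).
by rewrite norm_onZ lerD// ler_wpM2l.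
Qed.

Lemma slow_edge i j (e : edge i j) (x : vertex_space xi i) :
  slow x -> slow (edge_operator xi e x).
Proof.
move=> [C HC]; exists (C * rho) => k p.
have := HC _ (gpath_cat (gpath_rcons (gpath_nil i) e) p).
rewrite path_operator_cat /= !comp_lfunE id_lfunE gpath_size_cat /= add1n.
by rewrite exprS mulrA.
Qed.

Lemma nondefective_of_slow :
  (forall i (x : vertex_space xi i), slow x) -> nondefective N.
Proof.
move=> all_slow.
have [rho0 _] := joint_spectral_radius_bound N.
have unif i : exists C : R, 0 <= C /\ forall j (p : gpath i j) x,
    N j (path_operator xi p x) <= C * rho ^+ gpath_size p * N i x.
  have [||x|C C0 HC] := @seminorm_uniform_bound _ _ (N i) {j & gpath i j}
    (fun a => N (tag a) \o path_operator xi (tagged a))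
    (fun a => rho ^+ gpath_size (tagged a)).
  - by move=> a; exact: seminorm_comp.
  - by move=> a; rewrite exprn_ge0.
  - by have [C HC] := all_slow i x; exists C => a; exact: HC.
  by exists C; split=> // j p x; exact: (HC (Tagged (gpath i) p)).
have [C HC] := choice unif.
exists (\sum_(i < nvertex G) C i) => i j p.
have [Ci0 Hi] := HC i.
apply: (@le_trans _ _ (C i * rho ^+ gpath_size p)).
  apply: operator_norm_le => [|x]; last exact: Hi.
  by rewrite mulr_ge0// exprn_ge0.
rewrite ler_wpM2r ?exprn_ge0// (bigD1 i)//= lerDl sumr_ge0// => k _.
by case: (HC k).
Qed.

(** Try the rates [rho + harmonic n].  If at some vertex all of them failed,
    then [seminorm_limit] would give a nonzero [x] with
    [N (Pi_p x) <= rho ^ |p| * N x] for all [p], a slow vector. *)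
Lemma expansion_of_no_slow :
  (forall i (x : vertex_space xi i), slow x -> x = 0) ->
  exists2 r, rho < r & expanding r.
Proof.
move=> no_slow.
have [rho0 _] := joint_spectral_radius_bound N.
have pow_cvg k : (rho + harmonic n) ^+ k @[n --> \oo] --> rho ^+ k.
  have rho_cvg : rho + harmonic n @[n --> \oo] --> rho.
    rewrite -[X in _ --> X]addr0.
    by apply: cvgD; [exact: cvg_cst | exact: cvg_harmonic].
  exact: (cvg_comp _ _ rho_cvg (@exprn_continuous R k rho)).
have expand i : exists n : nat, forall x : vertex_space xi i, x != 0 ->
    exists j (p : gpath i j),
    (rho + harmonic n) ^+ gpath_size p * N i x < N j (path_operator xi p x).
  apply: contrapT => /forallNP Hn.
  have [x x0 Hx] : exists2 x : vertex_space xi i, x != 0 &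
      forall a : {j & gpath i j}, N (tag a) (path_operator xi (tagged a) x) <=
        rho ^+ gpath_size (tagged a) * N i x.
    apply: (@seminorm_limit _ _ _
      (fun a => N (tag a) \o path_operator xi (tagged a)) (N i)
      (fun a n => (rho + harmonic n) ^+ gpath_size (tagged a))
      (fun a => rho ^+ gpath_size (tagged a))).
    - by move=> a; exact: seminorm_comp.
    - exact: seminorm_norm.
    - by move=> a; exact: pow_cvg.
    - move=> n; have /existsNP[x /not_implyP[x0 Hx]] := Hn n.
      exists x => // -[j p] /=; rewrite leNgt; apply/negP => px.
      by apply: Hx; exists j, p.
  case/eqP: x0; apply: no_slow; exists (N i x) => j p.
  by rewrite mulrC; exact: (Hx (Tagged (gpath i) p)).
have [m Hm] := choice expand.
(* The smallest of the finitely many rates serves all vertices. *)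
pose n := (\max_(i < nvertex G) m i)%N.
exists (rho + harmonic n); first by rewrite ltrDl harmonic_gt0.
move=> i x x0; have [j [p px]] := Hm i x x0; exists j, p.
apply: le_lt_trans px.
rewrite ler_wpM2r ?(seminorm_ge0 _ (seminorm_norm _))//.
apply: lerXn2r; rewrite ?nnegrE ?addr_ge0 ?harmonic_ge0// lerD2l.
by rewrite /harmonic /= lef_pV2 ?posrE// ler_nat ltnS; exact: leq_bigmax.
Qed.

End Growth.

Theorem theorem1 (R : realType) (G : multigraph) (xi : triplet R G)
    (dim_gt0 : forall i : vertex G, (1 <= \dim {: vertex_space xi i})%N)
    (xi_irr : irreducible_triplet xi) (N : multinorm xi) :
  nondefective N.
Proof.
have slow_space (i : vertex G) : exists W : {vspace vertex_space xi i},
    forall x, x \in W <-> slow N x.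
  by apply: vspace_of_closed; [exact: slow0 | exact: slow_linear].
pose W i := sval (cid (slow_space i)).
have WP i x : x \in W i <-> slow N x := svalP (cid (slow_space i)) x.
have W_inv (i j : vertex G) (e : edge i j) x :
    x \in W i -> edge_operator xi e x \in W j.
  by move=> /WP xs; apply/WP; exact: slow_edge.
have [W0|W1] := irreducible_invariant xi_irr W_inv; last first.
  by apply: nondefective_of_slow => i x; apply/WP; rewrite W1 memvf.
have [|r rhor r_exp] := @expansion_of_no_slow _ _ _ N.
  by move=> i x /WP; rewrite W0 memv0 => /eqP.
(* Expansion is contradictory as soon as there is a path: its first vertex
   carries a nonzero vector. *)
exists 0 => i j p; have x0 : vpick {: vertex_space xi i} != 0.
  by rewrite vpick0 -dimv_eq0 -lt0n dim_gt0.
by have := expanding_le_radius x0 r_exp; rewrite leNgt rhor.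
Qed.
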